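(* There is a map $F$ from the set of finite words with nonnegative integer letters to itself such that (i) $F(w)$ is a rearrangement of $w$ for every $w$, and the restriction of $F$ to each rearrangement class is a bijection of that class onto itself; and (ii) $(\mathrm{dec}\,w,\mathrm{single}\,w)=(\mathrm{wlec}\,F(w),\mathrm{wpix}\,F(w))$ for every $w$.
   Context: For $w=x_1\cdots x_n$, $i\in\{1,\dots,n-1\}$ is a decrease if $x_i\ge\cdots\ge x_j>x_{j+1}$ for some $i\le j\le n-1$; $\mathrm{dec}\,w$ counts them. A nonempty word is Lyndon if it has length $1$ or is lexicographically strictly greater than its proper cyclic rotations; for primitive words $w\preceq w'$ iff $w^b\le w'^b$ lexicographically for large $b$; every nonempty word factors uniquely as $l_1\cdots l_k$ with Lyndon words $l_1\preceq\cdots\preceq l_k$, and $\mathrm{single}\,w$ is the number of one-letter factors. An $H$-word is a word $x_1\cdots x_k$, $k\ge2$, with $x_1<x_2$ and either $k=2$ or $x_2\ge\cdots\ge x_k$; each word factors uniquely as $u\,h_1\cdots h_k$ with $u$ nonincreasing (possibly empty) and each $h_i$ an $H$-word; $\mathrm{wpix}\,w$ is the length of $u$ and $\mathrm{wlec}\,w=\sum_i\mathrm{inv}(\text{reverse of }h_i)$, $\mathrm{inv}$ counting pairs of positions $a<b$ with $x_a>x_b$. *)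

(* Defs.v *)
From mathcomp Require Import all_boot all_order all_algebra.
From mathcomp Require Import zify ring lra.

Set Implicit Arguments.
Unset Strict Implicit.
Unset Printing Implicit Defensive.

Notation word := (seq nat).

(* Lexicographic orders; a proper prefix of a word is smaller than the word. *)
Definition lexle (u v : word) : bool := (u <= v :> seqlexi nat)%O.
Definition lexlt (u v : word) : bool := (u < v :> seqlexi nat)%O.

(* Positions start at 0: the 1-based letter x_(i+1) is [nth 0 w i]. *)
Definition is_decrease (w : word) (i : 'I_(size w).-1) : bool :=
  [exists j : 'I_(size w).-1,
    [&& i <= j,
        [forall k : 'I_j, (i <= k) ==> (nth 0 w k >= nth 0 w k.+1)]
      & nth 0 w j > nth 0 w j.+1]].

Definition dec (w : word) : nat :=
  #|[set i : 'I_(size w).-1 | is_decrease i]|.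

Definition lyndon (w : word) : bool :=
  (w != [::]) &&
  ((size w == 1) ||
   [forall i : 'I_(size w), (0 < i) ==> lexlt (rot i w) w]).

Definition wpow (w : word) (b : nat) : word := flatten (nseq b w).

(* Only applied to Lyndon words, which are primitive. *)
Definition preceq (u v : word) : Prop :=
  exists B : nat, forall b : nat, B <= b -> lexle (wpow u b) (wpow v b).

Definition lyndon_factorization (w : word) (ls : seq word) : Prop :=
  [/\ flatten ls = w,
      all lyndon ls
    & forall i : nat, i.+1 < size ls ->
        preceq (nth [::] ls i) (nth [::] ls i.+1)].

Definition nonincreasing (u : word) : bool := sorted geq u.

Definition Hword (h : word) : bool :=
  if h is x1 :: x2 :: t then (x1 < x2) && nonincreasing (x2 :: t) else false.

Definition H_factorization (w : word) (f : word * seq word) : Prop :=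
  [/\ f.1 ++ flatten f.2 = w, nonincreasing f.1 & all Hword f.2].

Definition inv (w : word) : nat :=
  #|[set p : 'I_(size w) * 'I_(size w) |
      (p.1 < p.2) && (nth 0 w p.1 > nth 0 w p.2)]|.

Section HFactorization.

Lemma H_factorization_exists (w : word) : {f | H_factorization w f}.
Proof.
elim: w => [|x w [[u hs] [/= Ew Hu Hhs]]]; first by exists ([::], [::]).
case: u Ew Hu => [|y u] /= Ew Hu.
  by exists ([:: x], hs); split=> //=; rewrite Ew.
case: (ltnP x y) => xy.
  exists ([::], (x :: y :: u) :: hs); split=> //=; first by rewrite -Ew.
  by rewrite xy /nonincreasing /= Hu Hhs.
exists (x :: y :: u, hs); split=> //=; first by rewrite -Ew.
by rewrite /nonincreasing /= Hu andbT.
Qed.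

Lemma H_factorization_unique (w : word) f g :
  H_factorization w f -> H_factorization w g -> f = g.
Proof.
(* Peel off the first letter of the word. *)
have peel x v u hs : H_factorization (x :: v) (u, hs) ->
    (exists u', u = x :: u' /\ H_factorization v (u', hs)) \/
    (exists y h hs', [/\ u = [::], hs = (x :: y :: h) :: hs', x < y
       & H_factorization v (y :: h, hs')]).
  case=> /=; case: u => [|z u] /=.
    case: hs => [|[|a [|b h]] hs] //= [-> Ev] _ /andP[/andP[ab Hh] Hhs].
    by right; exists b, h, hs; split.
  case=> -> <- Hu Hhs; left; exists u; split=> //; split=> //=.
  exact: path_sorted Hu.
elim: w f g => [|x w IHw] [u hs] [v gs].
  case=> /=; case: u => // /=; case: hs => [|[|a h] hs] //= _ _ _.
  by case=> /=; case: v => // /=; case: gs => [|[|a h] gs].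
move=> Hf Hg.
case: (peel _ _ _ _ Hf) => [[u' [Eu Hu']]|[y [h [hs' [Eu Ehs xy Hh]]]]];
case: (peel _ _ _ _ Hg) => [[v' [Ev Hv']]|[z [k [gs' [Ev Egs xz Hk]]]]].
- by case: (IHw _ _ Hu' Hv') => E1 E2; rewrite Eu Ev E1 E2.
- case: (IHw _ _ Hu' Hk) Hf => E _ [_ /= + _]; rewrite Eu E.
  by rewrite /nonincreasing /= leqNgt xz.
- case: (IHw _ _ Hv' Hh) Hg => E _ [_ /= + _]; rewrite Ev E.
  by rewrite /nonincreasing /= leqNgt xy.
- by case: (IHw _ _ Hh Hk) => Ey Eh Ehs'; rewrite Eu Ev Ehs Egs Ey Eh Ehs'.
Qed.

End HFactorization.

(* A word [u] over the letters 0, ..., B-1 is read as a number in base B, and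
   [rho u] is the value of the periodic expansion 0.uuuu...  Comparing [rho]
   amounts to comparing [u ++ v] and [v ++ u] lexicographically. *)
Section LyndonFactorization.
Import Order.TTheory GRing.Theory Num.Theory.

Variable B : nat.
Hypothesis B_gt1 : 1 < B.

Implicit Types u v w l m p q : word.

Let ok (u : word) := all (ltn^~ B) u.

Fixpoint bval (u : word) : nat :=
  if u is x :: u' then x * B ^ size u' + bval u' else 0.

Definition rho (u : word) : rat :=
  ((bval u)%:R / (B%:R ^+ size u - 1))%R.

Lemma bval_cat u v : bval (u ++ v) = bval u * B ^ size v + bval v.
Proof. by elim: u => //= x u ->; rewrite size_cat expnD; lia. Qed.

Lemma bval_lt u : ok u -> bval u < B ^ size u.
Proof. by elim: u => //= x u IHu /andP[xB /IHu]; rewrite expnS; nia. Qed.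

Lemma lexlt_bval u v : size u = size v -> ok u -> ok v ->
  lexlt u v = (bval u < bval v).
Proof.
elim: u v => [|x u IHu] [|y v] //= [Es] /andP[xB Hu] /andP[yB Hv].
have := bval_lt Hu; have := bval_lt Hv.
rewrite /lexlt ltxi_cons.
have := IHu _ Es Hu Hv; rewrite /lexlt => ->; rewrite Es !leEnat.
by case: (ltngtP x y) => xy /=; nia.
Qed.

Lemma lexlt_cat u v s t : size u = size v -> lexlt u v ->
  lexlt (u ++ s) (v ++ t).
Proof.
elim: u v => [|x u IHu] [|y v] //= [Es].
rewrite /lexlt !ltxi_cons => /andP[-> /= /implyP H].
by apply/implyP => /H; apply: IHu.
Qed.

Lemma den_gt0 u : u != [::] -> (0 < B%:R ^+ size u - 1 :> rat)%R.
Proof.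
case: u => // x u _; rewrite subr_gt0 -natrX (ltr_nat _ 1) /= expnS.
by have : 0 < B ^ size u; [rewrite expn_gt0; lia | nia].
Qed.

Lemma rho_cat u v : u != [::] -> v != [::] ->
  exists t : rat,
    [/\ (0 < t)%R, (t < 1)%R & rho (u ++ v) = (t * rho u + (1 - t) * rho v)%R].
Proof.
move=> u0 v0; have Du := den_gt0 u0; have Dv := den_gt0 v0.
have : (0 < B%:R ^+ size u * B%:R ^+ size v - 1 :> rat)%R.
  by rewrite -exprD -size_cat den_gt0 //; case: (u) u0.
rewrite /rho bval_cat size_cat exprD natrD natrM natrX.
move: Du Dv; set p := (_ ^+ size u)%R; set q := (_ ^+ size v)%R => Du Dv Dpq.
have q0 : (0 < q)%R by lra.
exists ((p - 1) * q / (p * q - 1))%R; split.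
- by rewrite divr_gt0 // mulr_gt0.
- by rewrite ltr_pdivrMr // mul1r mulrBl mul1r; lra.
- by field; rewrite !lt0r_neq0.
Qed.

Lemma rho_lexlt u v : ok u -> ok v -> u != [::] -> v != [::] ->
  lexlt (u ++ v) (v ++ u) = (rho u < rho v)%R.
Proof.
move=> Hu Hv u0 v0; rewrite lexlt_bval ?size_cat 1?addnC //; last 2 first.
- by rewrite /ok all_cat; apply/andP.
- by rewrite /ok all_cat; apply/andP.
rewrite /rho ltr_pdivrMr ?den_gt0 // mulrAC ltr_pdivlMr ?den_gt0 //.
rewrite !bval_cat -(ltr_nat rat) !natrD !natrM !natrX !mulrBr !mulr1.
by apply/idP/idP; lra.
Qed.

Lemma rho_lt_cat u v : u != [::] -> v != [::] -> (rho v < rho u)%R ->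
  (rho v < rho (u ++ v) < rho u)%R.
Proof.
by move=> u0 v0 uv; case: (rho_cat u0 v0) => t [t0 t1 ->]; apply/andP; nra.
Qed.

Lemma rho_cat_ge (r : rat) u v : u != [::] -> v != [::] ->
  (r <= rho u)%R -> (r <= rho v)%R -> (r <= rho (u ++ v))%R.
Proof. by move=> u0 v0 ru rv; case: (rho_cat u0 v0) => t [t0 t1 ->]; nra. Qed.

Lemma lyndonP w : ok w ->
  reflect (w != [::] /\ forall u v, w = u ++ v -> u != [::] -> v != [::] ->
             (rho v < rho u)%R)
    (lyndon w).
Proof.
move=> Hw; apply: (iffP andP) => [[w0 Hl]|[w0 Hl]]; split=> //.
  move=> u v Ew u0 v0; move: Hw; rewrite /ok Ew all_cat => /andP[Hu Hv].
  have su : 0 < size u by case: (u) u0.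
  have sv : 0 < size v by case: (v) v0.
  case/orP: Hl => [|/forallP Hl]; first by rewrite Ew size_cat; lia.
  have Hs : size u < size w by rewrite Ew size_cat; lia.
  have := Hl (Ordinal Hs); rewrite /= su /= {1 2}Ew rot_size_cat.
  by rewrite rho_lexlt.
apply/orP; right; apply/forallP => i; apply/implyP => i0.
have Ew := cat_take_drop i w.
have Ht : take i w != [::] by rewrite -size_eq0 size_take ltn_ord -lt0n.
have Hd : drop i w != [::] by rewrite -size_eq0 size_drop subn_eq0 -ltnNge.
move: Hw; rewrite /ok -{1}Ew all_cat => /andP[okt okd].
rewrite /rot; have := rho_lexlt okd okt Hd Ht; rewrite Ew => ->; exact: Hl.
Qed.

Lemma cat_eq_split u v p q : u ++ v = p ++ q -> size u < size p ->
  exists e : word, [/\ e != [::], p = u ++ e & v = e ++ q].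
Proof.
elim: u p => [|x u IHu] [|y p] //=; first by move=> -> _; exists (y :: p).
by case=> -> /IHu H /H[e [e0 -> ->]]; exists e.
Qed.

Lemma lyndon_cat u v : ok u -> ok v -> lyndon u -> lyndon v ->
  (rho v < rho u)%R -> lyndon (u ++ v).
Proof.
move=> Hu Hv /(lyndonP Hu)[u0 Lu] /(lyndonP Hv)[v0 Lv] uv.
apply/lyndonP; first by rewrite /ok all_cat; apply/andP.
split=> [|a b]; first by case: (u) u0.
case: (ltngtP (size a) (size u)) => sz E a0 b0.
- have [e [e0 Eu Eb]] := cat_eq_split (esym E) sz.
  have h3 := Lu _ _ Eu a0 e0.
  have := rho_lt_cat a0 e0 h3; rewrite -Eu => /andP[h1 h2].
  rewrite Eb; case: (rho_cat e0 v0) => t [t0 t1 ->]; nra.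
- have [e [e0 Ea Ev]] := cat_eq_split E sz.
  have h3 := Lv _ _ Ev e0 b0.
  have := rho_lt_cat e0 b0 h3; rewrite -Ev => /andP[h1 h2].
  rewrite Ea; case: (rho_cat u0 e0) => t [t0 t1 ->]; nra.
- by move/eqP: E; rewrite eqseq_cat // => /andP[/eqP <- /eqP <-].
Qed.

Lemma lyndon_rho_inj u v : ok u -> ok v -> lyndon u -> lyndon v ->
  rho u = rho v -> u = v.
Proof.
wlog suv : u v / size u <= size v.
  move=> H Hu Hv Lu Lv E.
  by case: (leqP (size u) (size v)) => [|/ltnW] s; [|symmetry]; apply: H.
move=> Hu Hv Lu Lv E; case/(lyndonP Hu): (Lu) => u0 _.
case/(lyndonP Hv): (Lv) => v0 Lv'.
have Euv : u ++ v = v ++ u.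
  have := rho_lexlt Hu Hv u0 v0; have := rho_lexlt Hv Hu v0 u0.
  rewrite E ltxx /lexlt => h1 h2.
  by apply/eqP; rewrite (@eq_le _ (seqlexi nat)) !leNgt h1 h2.
move: suv; rewrite leq_eqVlt => /orP[/eqP suv|suv].
  by move/eqP: Euv; rewrite eqseq_cat // => /andP[/eqP].
have [e [e0 Ev _]] := cat_eq_split Euv suv.
have := rho_lt_cat u0 e0 (Lv' _ _ Ev u0 e0).
by rewrite -Ev E ltxx andbF.
Qed.

Lemma size_wpow u b : size (wpow u b) = b * size u.
Proof. by elim: b => //= b IHb; rewrite size_cat IHb mulSn. Qed.

Lemma wpow_cat u b c : wpow u (b + c) = wpow u b ++ wpow u c.
Proof. by rewrite /wpow nseqD flatten_cat. Qed.

Lemma ok_wpow u b : ok u -> ok (wpow u b).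
Proof. by move=> Hu; elim: b => //= b IHb; rewrite /ok all_cat; apply/andP. Qed.

Lemma rho_wpow u b : u != [::] -> rho (wpow u b.+1) = rho u.
Proof.
move=> u0; elim: b => [|b IHb]; first by rewrite /wpow /= cats0.
have p0 : wpow u b.+1 != [::] by rewrite /wpow /=; case: (u) u0.
have -> : wpow u b.+2 = u ++ wpow u b.+1 by [].
by case: (rho_cat u0 p0) => t [_ _ ->]; rewrite IHb; ring.
Qed.

Lemma rho_lt_wpow u v : ok u -> ok v -> u != [::] -> v != [::] ->
  (rho u < rho v)%R ->
  forall b, size u + size v <= b -> lexlt (wpow u b) (wpow v b).
Proof.
move=> Hu Hv u0 v0 uv b Hb.
have su : 0 < size u by case: (u) u0.
have sv : 0 < size v by case: (v) v0.
rewrite -{1}(@subnKC (size v) b) 1?(leq_trans _ Hb) ?leq_addl //.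
rewrite -{2}(@subnKC (size u) b) 1?(leq_trans _ Hb) ?leq_addr // !wpow_cat.
have Es : size (wpow u (size v)) = size (wpow v (size u)).
  by rewrite !size_wpow mulnC.
apply: lexlt_cat => //; rewrite lexlt_bval ?ok_wpow //.
have Eu := rho_wpow (size v).-1 u0; have Ev := rho_wpow (size u).-1 v0.
have D : (0 < B%:R ^+ size (wpow v (size u)) - 1 :> rat)%R.
  by rewrite den_gt0 // -size_eq0 size_wpow muln_eq0 negb_or -!lt0n su.
move: uv; rewrite -Eu -Ev !prednK // /rho Es ltr_pM2r ?invr_gt0 //.
by rewrite ltr_nat.
Qed.

Lemma preceq_rho u v : ok u -> ok v -> lyndon u -> lyndon v ->
  preceq u v <-> (rho u <= rho v)%R.
Proof.
move=> Hu Hv Lu Lv; case/(lyndonP Hu): (Lu) => u0 _.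
case/(lyndonP Hv): (Lv) => v0 _; split=> [[b0 Hb]|].
  rewrite leNgt; apply/negP => vu.
  have h := rho_lt_wpow Hv Hu v0 u0 vu (leq_addr b0 _).
  by have := Hb _ (leq_addl (size v + size u) b0);
     rewrite /lexle leNgt -/(lexlt _ _) h.
rewrite le_eqVlt => /orP[/eqP E|uv].
  by exists 0 => b _; rewrite (lyndon_rho_inj Hu Hv Lu Lv E) /lexle lexx.
exists (size u + size v) => b Hb.
by rewrite /lexle ltW // -/(lexlt _ _) rho_lt_wpow.
Qed.

Let le_rho (u v : word) := (rho u <= rho v)%R.

Lemma ok_flatten ls : ok (flatten ls) = all ok ls.
Proof. by elim: ls => //= l ls <-; rewrite /ok all_cat. Qed.

Lemma lyndon_factorization_rho w ls : ok w ->
  lyndon_factorization w ls <->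
  [/\ flatten ls = w, all lyndon ls & sorted le_rho ls].
Proof.
move=> Hw; split=> -[E L S]; split=> //.
- apply/(sortedP [::]) => i Hi; have Hi' := ltnW Hi.
  move: Hw; rewrite -E ok_flatten => /allP Hok.
  by apply/preceq_rho; rewrite ?(Hok, allP L) ?mem_nth //; apply: S.
- move=> i Hi; have Hi' := ltnW Hi; move/(sortedP [::])/(_ _ Hi): S.
  move: Hw; rewrite -E ok_flatten => /allP Hok.
  by move=> h; apply/preceq_rho; rewrite ?(Hok, allP L) ?mem_nth.
Qed.

Lemma lyndon_insert l ls : ok l -> lyndon l -> ok (flatten ls) ->
  all lyndon ls -> sorted le_rho ls ->
  {ks | [/\ flatten ks = l ++ flatten ls, all lyndon ks & sorted le_rho ks]}.
Proof.
elim: ls l => [|m ms IH] l Hl Ll Hls Lls Sls.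
  by exists [:: l]; split=> //=; rewrite Ll.
case: (leP (rho l) (rho m)) => lm.
  by exists (l :: m :: ms); split=> //=; [rewrite Ll | rewrite /le_rho lm].
move: Hls Lls; rewrite /ok /= all_cat => /andP[Hm Hms] /andP[Lm Lms].
have [|||||ks [E L S]] := IH (l ++ m).
- by rewrite /ok all_cat; apply/andP.
- exact: lyndon_cat.
- by [].
- by [].
- exact: path_sorted Sls.
- by exists ks; split=> //; rewrite E catA.
Qed.

Lemma lyndon_exists_rho w : ok w ->
  {ls | [/\ flatten ls = w, all lyndon ls & sorted le_rho ls]}.
Proof.
elim: w => [|x w IHw] /=; first by exists [::].
case/andP=> xB /[dup] Hw /IHw[ls [E L S]].
have [|||||ks [Ek Lk Sk]] := @lyndon_insert [:: x] ls.
- by rewrite /ok /= xB.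
- by [].
- by rewrite E.
- by [].
- by [].
- by exists ks; split=> //; rewrite Ek E.
Qed.

Lemma rho_prefix_ge (r : rat) ls p q : ok (flatten ls) -> all lyndon ls ->
  all (fun l => (r <= rho l)%R) ls -> flatten ls = p ++ q -> p != [::] ->
  (r <= rho p)%R.
Proof.
elim: ls p => [|l ls IH] p /=; first by case: p.
rewrite /ok all_cat => /andP[Hl Hls] /andP[Ll Lls] /andP[rl rls] E p0.
case/(lyndonP Hl): Ll => l0 Ll.
case: (ltngtP (size l) (size p)) => sz.
- have [e [e0 -> El]] := cat_eq_split E sz.
  by rewrite rho_cat_ge //; apply: IH.
- have [e [e0 El _]] := cat_eq_split (esym E) sz.
  have := rho_lt_cat p0 e0 (Ll _ _ El p0 e0); rewrite -El => /andP[_ h].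
  exact: le_trans rl (ltW h).
- by move/eqP: E; rewrite eqseq_cat // => /andP[/eqP <-].
Qed.

Lemma lyndon_unique_rho w ls ms : ok w ->
  [/\ flatten ls = w, all lyndon ls & sorted le_rho ls] ->
  [/\ flatten ms = w, all lyndon ms & sorted le_rho ms] -> ls = ms.
Proof.
have tr : transitive le_rho by move=> a b c; apply: le_trans.
(* the first factors have the same length *)
have key l m ls' ms' : ok (l ++ flatten ls') -> size l < size m ->
    l ++ flatten ls' = m ++ flatten ms' -> lyndon l -> lyndon m ->
    all lyndon ls' -> path le_rho l ls' -> False.
  rewrite /ok all_cat => /andP[Hl Hls] sz E Ll Lm Lls S.
  have [e [d0 Em El]] := cat_eq_split E sz.
  have Hm : ok m.
    rewrite /ok Em all_cat; apply/andP; split=> //.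
    by move: Hls; rewrite El all_cat => /andP[].
  case/(lyndonP Hl): (Ll) => l0 _.
  case/(lyndonP Hm): (Lm) => _ /(_ _ _ Em l0 d0); rewrite ltNge => /negP; apply.
  apply: rho_prefix_ge Hls Lls _ El d0.
  exact: order_path_min S.
elim: ls ms w => [|l ls IH] [|m ms] w //= Hw [Ew L S] [Ew' L' S'].
- by move: Ew'; rewrite -Ew; case/andP: L' => /andP[+ _] _; case: (m).
- by move: Ew; rewrite -Ew'; case/andP: L => /andP[+ _] _; case: (l).
case/andP: L => Ll Lls; case/andP: L' => Lm Lms.
have E : l ++ flatten ls = m ++ flatten ms by rewrite Ew Ew'.
case: (ltngtP (size l) (size m)) => sz.
- by exfalso; apply: (key l m ls ms) => //; rewrite Ew.
- by exfalso; apply: (key m l ms ls) => //; rewrite Ew'.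
move/eqP: (E); rewrite eqseq_cat // => /andP[/eqP -> /eqP E'].
congr (_ :: _); apply: (IH _ (flatten ls)).
- by move: Hw; rewrite -Ew /ok all_cat => /andP[].
- by split=> //; apply: path_sorted S.
- by split=> //; apply: path_sorted S'.
Qed.

End LyndonFactorization.

Lemma letters_bounded (w : word) : {B | 1 < B & all (ltn^~ B) w}.
Proof.
exists (\max_(x <- w) x).+2 => //; apply/allP => x xw.
by rewrite /= ltnS leqW // (big_rem x) //= leq_maxl.
Qed.

Lemma lyndon_factorization_exists (w : word) :
  {ls | lyndon_factorization w ls}.
Proof.
have [B B1 Hw] := letters_bounded w; have [ls Hls] := lyndon_exists_rho B1 Hw.
by exists ls; apply/(lyndon_factorization_rho B1 _ Hw).
Qed.

Lemma lyndon_factorization_unique (w : word) ls ms :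
  lyndon_factorization w ls -> lyndon_factorization w ms -> ls = ms.
Proof.
have [B B1 Hw] := letters_bounded w.
move=> /(lyndon_factorization_rho B1 _ Hw) H1.
move=> /(lyndon_factorization_rho B1 _ Hw) H2.
exact: lyndon_unique_rho B1 _ _ _ Hw H1 H2.
Qed.

Definition lyndon_factors (w : word) : seq word :=
  sval (lyndon_factorization_exists w).

Definition single (w : word) : nat :=
  count (fun l : word => size l == 1) (lyndon_factors w).

Definition H_factors (w : word) : word * seq word :=
  sval (H_factorization_exists w).

Definition wpix (w : word) : nat := size (H_factors w).1.

Definition wlec (w : word) : nat :=
  \sum_(h <- (H_factors w).2) inv (rev h).

(* Main.v *)
(** A letter [drops] if the first later letter different from it is smaller;
    [dec] counts the dropping letters, and a letter is a one-letter Lyndon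
    factor iff it is a weak left-to-right maximum that does not drop.
    The inverse of F is built along the H-factorization [u h_1 ... h_k],
    starting from the nondecreasing rearrangement of [u].  An H-word
    [v z_2 >= ... >= z_k] with [z_j > v >= z_(j+1)] is rewritten as the chunk
    [z_2 ... z_j z_k ... z_(j+1) v] and inserted before the longest
    nondecreasing suffix whose letters are all [>= z_2].  The letters
    [z_2, ..., z_j] are exactly the dropping letters of the chunk, its other
    letters are smaller than [z_2], and the remaining letters keep their
    status, so [dec] grows by [inv (rev h)] while [single] is unchanged.  Every
    word with a descent arises by an insertion; a surjection preserving
    rearrangement classes is bijective on them, since they are finite. *)

Require Import Defs.
From mathcomp Require Import all_boot.
From mathcomp Require Import all_order zify.

Set Implicit Arguments.
Unset Strict Implicit.

Import Order.TTheory.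

(** * Recursive forms of the statistics, and the inverse map *)

Fixpoint drops (x : nat) (w : word) : bool :=
  if w is y :: w' then (y < x) || ((y == x) && drops y w') else false.

Fixpoint ndrops (w : word) : nat :=
  if w is x :: w' then drops x w' + ndrops w' else 0.

(* [m] is the maximum of the letters already read. *)
Fixpoint nsingles (m : nat) (w : word) : nat :=
  if w is x :: w' then
    ((m <= x) && ~~ drops x w') + nsingles (maxn m x) w'
  else 0.

Definition peak (h : word) : nat := nth 0 h 1.

Definition chunk (h : word) : word :=
  if h is v :: s then
    [seq y <- s | v < y] ++ rev (v :: [seq y <- s | y <= v])
  else [::].

(** [path leq (peak h) w] tests at once that [w] is nondecreasing and bounded below by the peak.
    Scanning from the left, the first suffix that passes is the longest one. *)
Fixpoint graft (h w : word) : word :=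
  if path leq (peak h) w then chunk h ++ w
  else if w is x :: w' then x :: graft h w' else chunk h.

Definition unfactor (w : word) : word :=
  foldl (fun w' h => graft h w') (rev (H_factors w).1) (H_factors w).2.

(** * Decreases as dropping letters *)

(** The first strict descent of a nonincreasing run already witnesses a decrease, so only letters
    equal to the one at [i] have to be skipped. *)
Lemma dropsP (w : word) (i : nat) : i < size w ->
  reflect (exists j, [/\ i <= j, j.+1 < size w,
             forall k, i <= k < j -> nth 0 w k.+1 <= nth 0 w k
           & nth 0 w j.+1 < nth 0 w j])
    (drops (nth 0 w i) (drop i.+1 w)).
Proof.
have [n] := ubnP (size w - i); elim: n i => // n IHn i Hn iw.
case: (ltnP i.+1 (size w)) => [i1w|wi]; last first.
  rewrite drop_oversize //=; constructor => -[j [ij jw _ _]]; lia.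
rewrite (drop_nth 0 i1w) /=; apply: (iffP orP) => [[lt|/andP[/eqP eqi]]|].
- by exists i; split=> // k; lia.
- case/IHn; [lia | exact: i1w |] => j [ij jw le lt].
  exists j; split=> //; [lia | move=> k /andP[ik kj]].
  by case: (eqVneq k i) => [->|?]; [rewrite eqi | apply: le; lia].
- case=> j [ij jw le lt]; case: (ltngtP (nth 0 w i.+1) (nth 0 w i)); [by left | |].
    case: (eqVneq i j) => [E|?]; first by rewrite E in lt *; lia.
    by have := le i; lia.
  move=> eqi; right; apply/andP; split=> //; apply/IHn => //; [lia|].
  exists j; split=> //; last by move=> k ?; apply: le; lia.
  case: (eqVneq i j) => [E|?]; last by lia.
  by move: lt; rewrite -E eqi ltnn.
Qed.

Lemma is_decreaseE (w : word) (i : 'I_(size w).-1) :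
  is_decrease i = drops (nth 0 w i) (drop i.+1 w).
Proof.
have iw : i < size w by have := ltn_ord i; lia.
apply/existsP/(dropsP iw) => [[j /and3P[ij /forallP le lt]]|[j [ij jw le lt]]].
  exists j; split=> //; first by have := ltn_ord j; lia.
  move=> k /andP[ik kj].
  by have /implyP := le (Ordinal kj); apply.
have jw' : j < (size w).-1 by lia.
exists (Ordinal jw'); rewrite /= ij lt andbT /=.
by apply/forallP => k; apply/implyP => ik; apply: le; rewrite ik /=.
Qed.

Lemma decE (w : word) : dec w = ndrops w.
Proof.
rewrite /dec -sum1dep_card big_mkcond /=.
under eq_bigr => i _ do rewrite is_decreaseE.
(* A sum over an integer range avoids ordinals whose type depends on [w] in the induction. *)
rewrite -(big_mkord xpredT
  (fun i => if drops (nth 0 w i) (drop i.+1 w) then 1 else 0)).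
elim: w => [|x [|y w] IHw]; [by rewrite big_geq | by rewrite big_geq |].
rewrite big_nat_recl // IHw /=.
by case: (_ || _).
Qed.

(** * Inversions of reversed H-words *)

Lemma inv_cons (x : nat) (w : word) :
  Defs.inv (x :: w) = count (ltn^~ x) w + Defs.inv w.
Proof.
have invE u : Defs.inv u =
    \sum_(i < size u) \sum_(j < size u) ((i < j) && (nth 0 u j < nth 0 u i)).
  rewrite pair_bigA /= /Defs.inv -sum1dep_card big_mkcond /=.
  by apply: eq_bigr => p _; case: (_ && _).
rewrite !invE /= !big_ord_recl /= add0n; congr (_ + _).
  rewrite -sum1_count (big_nth 0) big_mkord [RHS]big_mkcond.
  by apply: eq_bigr => i _ /=; rewrite add0n; case: (_ < _).
by apply: eq_bigr => i _; rewrite big_ord_recl /= add0n.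
Qed.

Lemma inv_rcons (s : word) (v : nat) : sorted leq s ->
  Defs.inv (rcons s v) = count (ltn v) s.
Proof.
elim: s => [|x s IHs] /= xs.
  by rewrite inv_cons /= add0n /Defs.inv; apply: eq_card0 => -[[]].
rewrite inv_cons (IHs (path_sorted xs)) -cats1 count_cat /= addn0.
congr (_ + _); rewrite -[RHS]add0n; congr (_ + _).
apply/eqP; rewrite -leqn0 leqNgt -has_count -all_predC.
have := order_path_min leq_trans xs.
by apply: sub_all => y /=; rewrite -leqNgt.
Qed.

(** The reverse is a nondecreasing word followed by the first letter of [h], so every inversion
    involves that letter. *)
Lemma inv_rev_Hword (h : word) : Hword h ->
  Defs.inv (rev h) = count (ltn (head 0 h)) h.
Proof.
case: h => [|v [|z t]] //= /andP[vz Ht].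
rewrite rev_cons inv_rcons ?rev_sorted // count_rev /= ltnn.
by case: (_ < _).
Qed.

(** * Grafting: rearrangement and number of dropping letters *)

Lemma perm_chunk (h : word) : perm_eq (chunk h) h.
Proof.
case: h => [|v s] //=; rewrite rev_cons -cats1 catA perm_catC /= perm_cons.
apply: perm_trans (_ : perm_eq _ ([seq y <- s | v < y] ++ [seq y <- s | y <= v])) _.
  by rewrite perm_cat2l perm_rev.
rewrite (@eq_filter _ (fun y => y <= v) (predC (ltn v))); last first.
  by move=> y /=; rewrite -leqNgt.
by rewrite perm_filterC.
Qed.

Lemma perm_graft (h w : word) : perm_eq (graft h w) (w ++ h).
Proof.
have base u : perm_eq (chunk h ++ u) (u ++ h).
  by rewrite perm_catC perm_cat2l perm_chunk.
elim: w => [|x w IHw] /=; first by rewrite cats0 perm_chunk.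
by case: ifP => // _; rewrite perm_cons.
Qed.

(* A letter weakly above the peak that precedes the insertion point exceeds
   the letter that followed it, so it still drops. *)
Lemma drops_graft (h w : word) (x : nat) : Hword h ->
  ~~ path leq (peak h) (x :: w) -> drops x (graft h w) = drops x w.
Proof.
move=> Hh; have [c cE] : exists c, chunk h = peak h :: c.
  by move: Hh; case: (h) => [|v [|z t]] //= /andP[vz _]; rewrite vz; eexists.
elim: w x => [|y w IHw] x /=.
  by rewrite cE /= !andbT -ltnNge; case: ltngtP.
case: ifP => [/andP[zy yw]|/negbT nzy /= _]; last first.
  congr (_ || _); case: (y =P x) => //= _; exact: IHw.
rewrite yw andbT cE negb_and -!ltnNge /=.
by case: (ltngtP y x); case: (ltngtP (peak h) x) => //=; lia.
Qed.

Lemma sorted_ndrops (w : word) : sorted leq w -> ndrops w = 0.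
Proof.
elim: w => //= x w IHw xw; rewrite (IHw (path_sorted xw)) addn0.
elim: w x xw {IHw} => //= y w IHw x /andP[xy /IHw].
by rewrite ltnNge xy; case: (drops y w); rewrite ?andbF.
Qed.

Lemma drops_cat_last (x v : nat) (s t : word) :
  v < x -> nonincreasing (x :: s) -> all (ltn v) s ->
  drops x (s ++ v :: t).
Proof.
rewrite /nonincreasing.
elim: s x => [|y s IHs] x /= vx; first by rewrite vx.
case/andP=> yx ys /andP[vy vs]; move: (yx : y <= x).
by rewrite leq_eqVlt => /orP[->|->] //; rewrite IHs ?orbT.
Qed.

Lemma ndrops_cat_last (v : nat) (s t : word) :
  nonincreasing s -> all (ltn v) s ->
  ndrops (s ++ v :: t) = size s + ndrops (v :: t).
Proof.
elim: s => //= x s IHs xs /andP[vx vs].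
by rewrite drops_cat_last // IHs // /nonincreasing (path_sorted xs).
Qed.

(** The letters of the chunk that are at most [v] lie below [z], and [z] bounds [w] from below.
    Hence nothing drops after the letters above [v]. *)
Lemma sorted_chunk_suffix (v z : nat) (t w : word) :
  v < z -> nonincreasing t -> path leq z w ->
  sorted leq (rev (v :: [seq y <- t | y <= v]) ++ w).
Proof.
move=> vz Ht zw; rewrite sorted_pairwise; last exact: leq_trans.
rewrite pairwise_cat -!(sorted_pairwise leq_trans) (path_sorted zw) andbT.
apply/andP; split.
  apply/allrelP => a b; rewrite mem_rev inE mem_filter => Ha bw.
  have /allP/(_ _ bw) zb := order_path_min leq_trans zw.
  case/orP: Ha => [/eqP ->|/andP[av _]]; lia.
rewrite rev_sorted /= path_min_sorted ?filter_all //.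
by apply: sorted_filter => // a b c ba ac; apply: leq_trans ac ba.
Qed.

Lemma ndrops_graft (h w : word) : Hword h ->
  ndrops (graft h w) = ndrops w + Defs.inv (rev h).
Proof.
move=> Hh; rewrite inv_rev_Hword //.
have base u : path leq (peak h) u ->
    ndrops (chunk h ++ u) = count (ltn (head 0 h)) h.
  move: Hh; case: (h) => [|v [|z t]] // /andP[vz Ht] zu.
  have Htail := sorted_chunk_suffix vz Ht zu.
  have lowv : all (geq v) (rev (v :: [seq y <- z :: t | y <= v])).
    by apply/allP => a; rewrite mem_rev inE mem_filter /=; lia.
  rewrite /chunk -catA; move: Htail lowv; set hi := [seq y <- _ | v < y].
  case E: (rev _) => [|y low] /= Hlow.
    by move/(congr1 size): E; rewrite size_rev.
  (* The low part starts with some [y <= v], so the run of letters above [v] ends in a strict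
     descent and all of them drop. *)
  case/andP=> yv _; rewrite ndrops_cat_last.
  - by rewrite (@sorted_ndrops (y :: _)) // addn0 /hi size_filter /= ltnn.
  - exact: (sorted_filter (rev_trans leq_trans) _ Ht).
  - by apply/allP => a; rewrite mem_filter /= => /andP[va _]; lia.
elim: w => [|x w IHw] /=.
  by rewrite base.
case: ifP => [xw|/negbT nxw /=].
  rewrite base //= addnC -[LHS]addn0; congr (_ + _).
  exact/esym/(@sorted_ndrops (x :: w))/path_sorted/xw.
by rewrite drops_graft //= IHw addnA.
Qed.

(** * Grafting and one-letter factors *)

Lemma nsingles_below (m : nat) (s w : word) :
  all (ltn^~ m) s -> nsingles m (s ++ w) = nsingles m w.
Proof.
elim: s => //= x s IHs /andP[xm sm].
by rewrite leqNgt xm /= (maxn_idPl (ltnW xm)) IHs.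
Qed.

Lemma nsingles_dropping (m v : nat) (s w : word) :
  nonincreasing s -> all (ltn v) s ->
  nsingles m (s ++ v :: w) = nsingles (foldl maxn m s) (v :: w).
Proof.
elim: s m => // x s IHs m xs /andP[vx vs].
by rewrite /= drops_cat_last // andbF IHs // /nonincreasing (path_sorted xs).
Qed.

(** The first letter is at least [z], so its test has the same outcome for both maxima, and they
    agree once it is read. *)
Lemma nsingles_maxn (m z : nat) (w : word) :
  all (leq z) w -> nsingles (maxn m z) w = nsingles m w.
Proof.
case: w => //= x w /andP[zx _]; rewrite geq_max zx andbT.
by rewrite -maxnA (maxn_idPr zx).
Qed.

Lemma foldl_maxn_path (m x : nat) (s : word) :
  nonincreasing (x :: s) -> foldl maxn m (x :: s) = maxn m x.
Proof.
move=> xs /=; have := order_path_min (rev_trans leq_trans) xs.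
elim: s {xs} => //= y s IHs /andP[yx]; rewrite -maxnA (maxn_idPl yx).
exact: IHs.
Qed.

(** In the chunk, letters above [v] drop and the others stay below the running maximum, which the
    peak has raised. The raise is harmless afterwards, since all later letters are at least the
    peak. *)
Lemma nsingles_graft (h w : word) (m : nat) : Hword h ->
  nsingles m (graft h w) = nsingles m w.
Proof.
move=> Hh.
have base k u : path leq (peak h) u -> nsingles k (chunk h ++ u) = nsingles k u.
  move: Hh; case: (h) => [|v [|z t]] // /andP[vz Ht] zu.
  rewrite [peak _]/= in zu.
  rewrite /chunk -catA -(nsingles_maxn k (order_path_min leq_trans zu)).
  have zs : nonincreasing (z :: [seq y <- t | v < y]).
    have := @sorted_filter _ geq (rev_trans leq_trans) (ltn v) _ Ht.
    by rewrite /= vz.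
  have -> : [seq y <- z :: t | v < y] = z :: [seq y <- t | v < y].
    by rewrite /= vz.
  set low := rev _.
  have lowz : all (ltn^~ (maxn k z)) low.
    by apply/allP => a; rewrite mem_rev inE mem_filter /=; lia.
  have lowv : all (geq v) low.
    by apply/allP => a; rewrite mem_rev inE mem_filter /=; lia.
  have: low != [::] by rewrite -size_eq0 size_rev.
  case: low lowz lowv => // a low lowz /andP[av _] _.
  rewrite [(a :: low) ++ u]cat_cons nsingles_dropping //.
    by rewrite foldl_maxn_path // -cat_cons nsingles_below.
  have {}av : a <= v := av.
  by apply/allP => b; rewrite inE mem_filter /=; lia.
elim: w m => [|x w IHw] m /=.
  by rewrite base.
case: ifP => [xw|/negbT nxw /=]; first by rewrite base.
by rewrite drops_graft //= IHw.
Qed.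

(** * Words with a descent as grafts *)

Lemma sorted_split (x : nat) (w : word) : sorted leq w ->
  [seq y <- w | y < x] ++ [seq y <- w | x <= y] = w.
Proof.
elim: w => //= y w IHw yw; case: ltnP => xy.
  by rewrite cat_cons (IHw (path_sorted yw)).
have xw : all (leq x) w.
  by apply: sub_all (order_path_min leq_trans yw) => z; apply: leq_trans.
rewrite (all_filterP xw) (_ : [seq _ <- w | _ < x] = [::]) //.
by apply/eqP; rewrite -(negbK (_ == _)) -has_filter -all_predC;
   apply: sub_all xw => z /=; rewrite -leqNgt.
Qed.

(* If the tail of the word already is a graft, prepending [x] either commutes
   with the grafting or lengthens the grafted H-word by the letter [x]. *)
Lemma graft_onto (w : word) : ~~ sorted leq w ->
  exists h w', [/\ Hword h, graft h w' = w & size w' < size w].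
Proof.
have graft_path h u : path leq (peak h) u -> graft h u = chunk h ++ u.
  by case: u => [|y u] //= ->.
elim: w => // x w IHw nxw; case: (boolP (sorted leq w)) => [Hw|nw].
  have hi_path : path leq x [seq y <- w | x <= y].
    by rewrite path_min_sorted ?filter_all // sorted_filter //; apply: leq_trans.
  have := sorted_split x Hw.
  have := sorted_filter leq_trans (ltn^~ x) Hw.
  have := filter_all (ltn^~ x) w.
  case/lastP: [seq y <- w | y < x] => [|l v] lox Hlo Ew.
    by case/negP: nxw; rewrite /= -Ew.
  move: lox; rewrite all_rcons => /andP[vx lx].
  have {}vx : v < x := vx.
  move: Hlo; rewrite -rev_sorted rev_rcons => Hlo.
  have lv : all (geq v) (rev l) := order_path_min (rev_trans leq_trans) Hlo.
  (* Here [w] is [l], then [v], then letters [>= x]; and [x], [l], [v] is the chunk of this H-word,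
     whose peak is [x]. *)
  exists [:: v, x & rev l], [seq y <- w | x <= y]; split.
  - rewrite /= vx /nonincreasing /= path_min_sorted ?(path_sorted Hlo) // all_rev.
    by apply: sub_all lx => y /ltnW.
  - rewrite graft_path // -[in RHS]Ew /= vx [x <= v]leqNgt vx /= (all_filterP lv).
    rewrite (_ : [seq _ <- _ | v < _] = [::]) /= ?rev_cons ?revK //.
    apply/eqP; rewrite -(negbK (_ == _)) -has_filter -all_predC.
    by apply: sub_all lv => y /=; rewrite -leqNgt.
  - by rewrite /= ltnS size_filter count_size.
case/IHw: nw => h [w' [Hh Ew sz]].
case: (boolP (path leq (peak h) (x :: w'))) => [/andP[zx xw]|npath].
  move: Hh Ew zx; case: h => [|v [|z t]] // /andP[vz Ht] Ew zx.
  have vx : v < x := leq_trans vz zx.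
  exists [:: v, x, z & t], w'; split; last 1 first.
  - by rewrite /= ltnS ltnW.
  - by rewrite /= vx /nonincreasing /= [_ <= x]zx.
  rewrite graft_path // -Ew graft_path. 2: exact: (@path_le _ leq leq_trans _ x).
  by rewrite /chunk /= vx [x <= v]leqNgt vx.
exists h, (x :: w'); split=> //.
by rewrite /= [_ && _](negbTE npath) Ew.
Qed.

(** * Surjectivity of [unfactor] and transport of the statistics *)

Lemma perm_unfactor (w : word) : perm_eq (unfactor w) w.
Proof.
rewrite /unfactor; case: (svalP (H_factorization_exists w)).
rewrite -/(H_factors w); case: (H_factors w) => u hs /= <- _ _.
elim/last_ind: hs => [|hs h IHhs] /=; first by rewrite cats0 perm_rev.
rewrite foldl_rcons flatten_rcons catA (permPl (perm_graft _ _)).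
by rewrite perm_cat2r.
Qed.

Lemma unfactor_onto (w : word) : exists w', unfactor w' = w.
Proof.
have [n] := ubnP (size w); elim: n w => // n IHn w sw.
have H_factorsE v f : H_factorization v f -> H_factors v = f.
  exact/H_factorization_unique/(svalP (H_factorization_exists v)).
case: (boolP (sorted leq w)) => [Hw|/graft_onto[h [w1 [Hh Ew sz]]]].
  exists (rev w); rewrite /unfactor (H_factorsE _ (rev w, [::])) /= ?revK //.
  by split; rewrite /= ?cats0 // /nonincreasing rev_sorted.
have [|w2 Ew2] := IHn w1; first by apply: leq_trans sz _.
(* By uniqueness of the factorization, appending [h] to [w2] appends it to the list of H-factors. *)
exists (w2 ++ h); move: Ew2; rewrite /unfactor.
case: (svalP (H_factorization_exists w2)); rewrite -/(H_factors w2).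
case: (H_factors w2) => u hs /= E Hu Hhs E1.
rewrite (H_factorsE _ (u, rcons hs h)) /= ?foldl_rcons ?E1 //.
by split; rewrite //= ?flatten_rcons ?catA ?E // all_rcons Hh.
Qed.

Lemma ndrops_unfactor (w : word) : ndrops (unfactor w) = wlec w.
Proof.
rewrite /unfactor /wlec; case: (svalP (H_factorization_exists w)).
rewrite -/(H_factors w); case: (H_factors w) => u hs /= _ Hu.
elim/last_ind: hs => [|hs h IHhs] /=.
  by rewrite big_nil sorted_ndrops // rev_sorted.
rewrite all_rcons => /andP[Hh /IHhs E].
by rewrite foldl_rcons ndrops_graft // E -cats1 big_cat big_seq1.
Qed.

Lemma nsingles_sorted (m : nat) (w : word) :
  path leq m w -> nsingles m w = size w.
Proof.
elim: w m => //= x w IHw m /andP[mx xw].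
rewrite mx (maxn_idPr mx) IHw //; have := sorted_ndrops (w := x :: w) xw.
by rewrite /=; case: (drops x w).
Qed.

Lemma nsingles_unfactor (w : word) : nsingles 0 (unfactor w) = wpix w.
Proof.
rewrite /unfactor /wpix; case: (svalP (H_factorization_exists w)).
rewrite -/(H_factors w); case: (H_factors w) => u hs /= _ Hu.
elim/last_ind: hs => [|hs h IHhs] /=.
  rewrite nsingles_sorted ?size_rev //.
  by rewrite path_min_sorted ?rev_sorted //; apply/allP.
rewrite all_rcons => /andP[Hh /IHhs E].
by rewrite foldl_rcons nsingles_graft.
Qed.

(** * One-letter Lyndon factors as letters *)

Lemma lexlt_cons (x y : nat) (u v : word) :
  lexlt (x :: u) (y :: v) = (x < y) || ((x == y) && lexlt u v).
Proof. by rewrite /lexlt ltxi_cons !leEnat; case: ltngtP. Qed.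

Lemma lexle_cons (x y : nat) (u v : word) :
  lexle (x :: u) (y :: v) = (x < y) || ((x == y) && lexle u v).
Proof. by rewrite /lexle lexi_cons !leEnat; case: ltngtP. Qed.

Lemma lexlt_rotr_max (x : nat) (s : word) :
  all (geq x) s -> ~~ lexlt (x :: s) (rcons s x).
Proof.
elim: s => [|y s IHs] /=; first by rewrite /lexlt ltxx.
case/andP=> yx /IHs; rewrite lexlt_cons negb_or => ns; rewrite -leqNgt yx /=.
by case: (x =P y) => //= <-.
Qed.

(** Comparing first letters with the rotations makes [x] maximal. If a longer word also ended in
    [x], moving that [x] to the front would not give a smaller word. *)
Lemma lyndon_head_last (x : nat) (s : word) : lyndon (x :: s) ->
  all (geq x) s /\ (s != [::] -> last x s < x).
Proof.
case: (altP (s =P [::])) => [->|s0] //= /andP[_ /orP[]].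
  by rewrite eqSS size_eq0 (negbTE s0).
move=> /forallP Hrot.
have Hs : all (geq x) s.
  apply/(all_nthP 0) => i Hi.
  have Hi' : i.+1 < size (x :: s) by [].
  have := Hrot (Ordinal Hi'); rewrite /= /rot [drop _ _]/= (drop_nth 0 Hi).
  by rewrite cat_cons lexlt_cons; case: ltngtP => //=.
split=> // _; move: s0 Hs Hrot; case/lastP: s => // s y _.
rewrite all_rcons last_rcons => /andP[yx Hs] Hrot.
rewrite ltn_neqAle [y <= x]yx andbT; apply/eqP => E.
have Hi : (size s).+1 < size (x :: rcons s y) by rewrite /= size_rcons.
have := Hrot (Ordinal Hi).
rewrite implyTb /= -rcons_cons -cats1.
rewrite (_ : (size s).+1 = size (x :: s)) // rot_size_cat E /= lexlt_cons ltnn.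
by rewrite eqxx cats1 (negbTE (lexlt_rotr_max Hs)).
Qed.

Lemma preceq_head (x y : nat) (s t : word) :
  preceq (x :: s) (y :: t) -> x <= y.
Proof.
case=> b /(_ b.+1 (leqnSn b)); rewrite /wpow /= lexle_cons.
by case: ltngtP.
Qed.

Lemma lexle_nseq (x k : nat) (u v : word) :
  all (geq x) u -> lexle (nseq (size u + k) x) (u ++ v) -> all (pred1 x) u.
Proof.
elim: u => //= y u IHu /andP[yx Hu]; rewrite lexle_cons ltnNge [y <= x]yx /=.
by case/andP=> /eqP <- /(IHu Hu) ->; rewrite eqxx.
Qed.

(** Comparing high powers forces [x :: t] to be constant, whereas a longer Lyndon word ends in a
    letter below [x]. *)
Lemma preceq_letter (x : nat) (t : word) :
  lyndon (x :: t) -> preceq [:: x] (x :: t) -> t = [::].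
Proof.
move=> /lyndon_head_last[Ht lt] [b /(_ (size (x :: t) + b) (leq_addl _ _))].
have -> k : wpow [:: x] k = nseq k x by rewrite /wpow; elim: k => //= k ->.
move=> /(@lexle_nseq x b (x :: t) (wpow (x :: t) (size t + b))) Hall.
have /Hall /= /andP[_ /allP allx] : all (geq x) (x :: t) by rewrite /= leqnn Ht.
case: t Ht lt {Hall} allx => // y t _ /(_ isT) /= lt /(_ _ (mem_last y t)) /=.
by move/eqP => E; rewrite E ltnn in lt.
Qed.

Definition preceq_chain (ls : seq word) : Prop :=
  forall i, i.+1 < size ls -> preceq (nth [::] ls i) (nth [::] ls i.+1).

(** The next factor starts with a letter at least [x]; in case of equality it is the single letter
    [x], and the argument repeats. *)
Lemma drops_flatten (x : nat) (ls : seq word) :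
  all lyndon ls -> preceq_chain ([:: x] :: ls) -> ~~ drops x (flatten ls).
Proof.
elim: ls => // -[|y t] ls IHls; first by [].
case/andP=> Ly Lls chain.
have xy : preceq [:: x] (y :: t) by apply: (chain 0).
have := preceq_head xy.
rewrite leq_eqVlt => /orP[/eqP E|lt] /=; last by case: ltngtP lt.
rewrite -{y}E in xy Ly chain *; rewrite (preceq_letter Ly xy) in chain *.
rewrite ltnn eqxx; apply: IHls => // i Hi.
exact: (chain i.+1).
Qed.

Lemma drops_last (x : nat) (s w : word) :
  all (geq x) s -> last x s < x -> drops x (s ++ w).
Proof.
elim: s => [|y s IHs] /=; first by rewrite ltnn.
case/andP=> yx Hs lt; move: (yx : y <= x).
rewrite leq_eqVlt => /orP[/eqP E|->] //.
by rewrite E eqxx IHs ?orbT // -{1}E.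
Qed.

(** Letters below [x] are no weak maxima, and letters equal to [x] drop because [s] ends below
    [x]. *)
Lemma nsingles_tail (x : nat) (s w : word) :
  all (geq x) s -> (s != [::] -> last x s < x) ->
  nsingles x (s ++ w) = nsingles x w.
Proof.
elim: s => // y s IHs /andP[yx Hs] /(_ isT) /= lt.
have {}yx : y <= x := yx.
rewrite (maxn_idPl yx) IHs //; last by case: (s) lt.
case: ltngtP yx => //= E _; rewrite -E in lt *.
by rewrite drops_last // E.
Qed.

(** First letters of the factors are nondecreasing, hence weak left-to-right maxima, and such a
    letter drops exactly when its factor is longer than one letter. The default [m] of [head] makes
    the bound hold for the empty list. *)
Lemma nsingles_flatten (m : nat) (ls : seq word) :
  all lyndon ls -> preceq_chain ls -> m <= head m (flatten ls) ->
  nsingles m (flatten ls) = count (fun l : word => size l == 1) ls.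
Proof.
elim: ls m => // -[|x s] ls IHls m; first by [].
case/andP=> Ll Lls chain /= mx.
have [Hs lt] := lyndon_head_last Ll.
have chain' : preceq_chain ls by move=> i Hi; apply: (chain i.+1).
have xls : x <= head x (flatten ls).
  case: ls Lls chain {IHls chain'} => // -[|y t] ls // _ chain.
  exact: preceq_head (chain 0 isT).
rewrite mx (maxn_idPr mx) nsingles_tail // IHls //; congr (_ + _).
rewrite eqSS size_eq0; case: (altP (s =P [::])) => [E|s0].
  by rewrite E in chain *; rewrite drops_flatten.
by rewrite drops_last ?lt.
Qed.

Lemma singleE (w : word) : single w = nsingles 0 w.
Proof.
rewrite /single; case: (svalP (lyndon_factorization_exists w)).
by rewrite -/(lyndon_factors w) => E L chain; rewrite -[in RHS]E nsingles_flatten.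
Qed.

Theorem theorem6p1 :
  exists F : word -> word,
    [/\ forall w : word, perm_eq (F w) w,
        forall c : word,
          (forall u v : word,
             perm_eq u c -> perm_eq v c -> F u = F v -> u = v) /\
          (forall v : word,
             perm_eq v c -> exists2 u : word, perm_eq u c & F u = v)
      & forall w : word, (dec w, single w) = (wlec (F w), wpix (F w))].
Proof.
have onto w : exists v, unfactor v == w.
  by have [v <-] := unfactor_onto w; exists v.
pose F w := xchoose (onto w).
have FK : cancel F unfactor by move=> w; apply/eqP/(xchooseP (onto w)).
have permF w : perm_eq (F w) w by rewrite perm_sym -{1}(FK w) perm_unfactor.
exists F; split=> // [c|w].
  split=> [u v _ _|v vc]; first exact: (can_inj FK).
  (* [permutations c] lists the class of [c] without repetition, so the injective image of this list
     inside the class exhausts it by size. *)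
  have [|||_ Fc] := @uniq_min_size _ (map F (permutations c)) (permutations c).
  - by rewrite (map_inj_uniq (can_inj FK)) permutations_uniq.
  - move=> _ /mapP[u uc ->]; move: uc; rewrite !mem_permutations.
    exact: perm_trans.
  - by rewrite size_map.
  have: v \in map F (permutations c) by rewrite Fc mem_permutations.
  by case/mapP=> u; rewrite mem_permutations => uc ->; exists u.
by rewrite decE singleE -{1 2}(FK w) ndrops_unfactor nsingles_unfactor.
Qed.
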